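(* Let $\vec b=(b_0,b_1,b_2,\dots)$ be a sequence of integers and let the height bound be $s=4$. With $A_n,B_n,C_n$ the weighted counts of $3$-dimensional $4$-bounded paths defined in the context (so that $A_n=C^{\vec b}_{3,4,n}$ is the $n$-th $3$-dimensional $4$-bounded weighted Catalan number), for all $n\ge 1$, $$\begin{bmatrix} A_n \\ {B_n} \\ {C_n} \end{bmatrix} = \begin{bmatrix} b_0 & b_0b_1+b_0b_2 & 0 \\ 2 & 2b_1+2b_2 & b_2 \\ 1 & b_1+b_2 & b_2 \end{bmatrix} \begin{bmatrix} A_{n-1} \\ {B_{n-1}} \\ {C_{n-1}} \end{bmatrix}.$$
   Context: Consider lattice paths in $\mathbb{Z}^3$ whose steps are standard unit vectors $\vec e_1,\vec e_2,\vec e_3$ and all of whose points $x=(x_1,x_2,x_3)$ (endpoints included) satisfy $x_1\ge x_2\ge x_3$ and $h(x)\le s$, where $h(x)=2x_1-x_2-x_3$ is the height. The weight of such a path with respect to $\vec b$ is the product, over all its $\vec e_1$-steps (up-steps), of $b_{h}$, where $h$ is the height of the starting point of that step (empty product $=1$). For $n\ge 0$ let $A_n$ be the sum of weights of all such paths from $(0,0,0)$ to $(n,n,n)$; $B_n$ the sum of weights of all such paths from $(2,1,0)$ to $(n+1,n+1,n+1)$; and $C_n$ the sum of weights of all such paths from $(3,3,0)$ to $(n+2,n+2,n+2)$. In particular $(A_0,B_0,C_0)=(1,0,0)$, and $C^{\vec b}_{3,s,n}=A_n$ is the $3$-dimensional $s$-bounded weighted Catalan number. *)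

(* Defs.v *)
From HB Require Import structures.
From mathcomp Require Import all_boot all_order all_algebra.
From mathcomp Require Import zify.

Set Implicit Arguments.
Unset Strict Implicit.
Unset Printing Implicit Defensive.

Import Order.TTheory GRing.Theory Num.Theory.
Local Open Scope ring_scope.

Definition row3 (R : Type) (a b c : R) : 'rV[R]_3 :=
  \row_(j < 3) nth a [:: a; b; c] j.

Definition col3 (R : Type) (a b c : R) : 'cV[R]_3 := (row3 a b c)^T.

Definition rows3 (R : Type) (u v w : 'rV[R]_3) : 'M[R]_3 :=
  \matrix_(i < 3) nth u [:: u; v; w] i.

(* The coordinates x_1, x_2, x_3 of a point of Z^3 are x 0 0, x 0 1, x 0 2. *)
Definition point := 'rV[int]_3.

Definition unit_step (i : 'I_3) : point := delta_mx 0 i.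

Definition height (x : point) : int := 2 * x 0 0 - x 0 1 - x 0 2.

Definition admissible (s : nat) (x : point) : bool :=
  [&& x 0 1 <= x 0 0, x 0 2 <= x 0 1 & height x <= s%:Z].

(* A lattice path is encoded by its starting point x and the word w of its
   step directions. *)
Fixpoint path_points (x : point) (w : seq 'I_3) : seq point :=
  x :: (if w is i :: w' then path_points (x + unit_step i) w' else [::]).

Definition is_path (s : nat) (x y : point) (w : seq 'I_3) : bool :=
  all (admissible s) (path_points x w) && (last x (path_points x w) == y).

(* The height of an admissible point is nonnegative, so the absolute value
   only converts it to a natural number index. *)
Fixpoint path_weight (b : nat -> int) (x : point) (w : seq 'I_3) : int :=
  if w is i :: w' then
    (if i == 0 then b `|height x|%N else 1)
      * path_weight b (x + unit_step i) w'
  else 1.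

Definition coord_sum (x : point) : int := \sum_(i < 3) x 0 i.

Definition path_length (x y : point) : nat := `|coord_sum y - coord_sum x|%N.

(* All paths from x to y have the same length, so that summing over words of
   length path_length x y, as in path_sum below, is summing over all paths. *)
Lemma size_path (s : nat) (x y : point) (w : seq 'I_3) :
  is_path s x y w -> size w = path_length x y.
Proof.
have sum_last u v : coord_sum (last u (path_points u v)) =
    coord_sum u + (size v)%:Z.
  elim: v u => [|i v IHv] u /=; first by rewrite addr0.
  have -> : last u (path_points (u + unit_step i) v) =
            last (u + unit_step i) (path_points (u + unit_step i) v).
    by case: v {IHv}.
  rewrite IHv /coord_sum.
  under eq_bigr => j _ do rewrite !mxE eqxx /=.
  rewrite big_split /= [X in _ + X + _](bigD1 i) //= eqxx.
  rewrite [X in _ + (_ + X)]big1 ?addr0 => [|j /negPf ->] //.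
  by rewrite -addrA -intS.
by case/andP=> _ /eqP <-; rewrite /path_length sum_last; lia.
Qed.

Definition path_sum (b : nat -> int) (s : nat) (x y : point) : int :=
  \sum_(w : (path_length x y).-tuple 'I_3 | is_path s x y w) path_weight b x w.

Definition diag_point (n : nat) : point := const_mx n%:Z.

Definition weighted_catalan3 (b : nat -> int) (s n : nat) : int :=
  path_sum b s 0 (diag_point n).

Definition A (b : nat -> int) (n : nat) : int := weighted_catalan3 b 4 n.

Definition B (b : nat -> int) (n : nat) : int :=
  path_sum b 4 (row3 2 1 0) (diag_point n.+1).

Definition C (b : nat -> int) (n : nat) : int :=
  path_sum b 4 (row3 3 3 0) (diag_point n.+2).

(* Main.v *)
Require Import Defs.
From mathcomp Require Import all_boot all_order all_algebra.
From mathcomp Require Import zify ring.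
Local Open Scope ring_scope.

Import GRing.Theory.

(** The diagonal vector (1,1,1) changes neither the order of the coordinates
nor the height, so only the gaps [p = x_1 - x_2] and [q = x_2 - x_3] of a
point [x] matter: [x] is ordered exactly when both gaps are natural numbers,
its height is [2 * p + q], and among the points with a given coordinate sum
the diagonal point is the one with gaps (0,0).  A path to the diagonal is
therefore the same thing as a walk to (0,0) on pairs of gaps, on which the
steps e_1, e_2, e_3 act by

   (p, q) -> (p+1, q),   (p, q) -> (p-1, q+1),   (p, q) -> (p, q-1).

The function [gap_walks] counts these walks with weights, and
[paths_to_diagonal] identifies it with the sum over paths.  The starting
points of A_n, B_n, C_n have gaps (0,0), (1,1), (0,3), and in all three cases
the number of steps is 3n.

For height bound 4 there are only nine pairs of gaps.  Since each step
changes the coordinate sum by 1, it changes [p - q] modulo 3 by 1, so that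
three steps lead from the set {(0,0), (1,1), (0,3)} back to itself, as this is
the set of the pairs of height at most 4 with [p - q] divisible by 3.
Unfolding the recursion of [gap_walks] three times from each of these pairs
gives the three rows of the matrix. *)

(** * Sums over paths with a prescribed number of steps *)

Definition paths_sum (b : nat -> int) (s N : nat) (x y : point) : int :=
  \sum_(w : N.-tuple 'I_3 | is_path s x y w) path_weight b x w.

Lemma is_path_cons s x y i w :
  is_path s x y (i :: w) = admissible s x && is_path s (x + unit_step i) y w.
Proof. by rewrite /is_path /= -andbA; case: w => [|j w]. Qed.

Lemma paths_sum_inadmissible b s N x y :
  ~~ admissible s x -> paths_sum b s N x y = 0.
Proof.
move=> /negPf nadm; apply: big_pred0 => w.
by case: (tval w) => [|i v]; rewrite /is_path /= nadm.
Qed.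

Lemma paths_sum0 b s x y :
  paths_sum b s 0 x y = (admissible s x && (x == y))%:R.
Proof.
rewrite /paths_sum (eq_bigl (fun=> admissible s x && (x == y))).
  rewrite (eq_bigr (fun=> 1)) => [|w _]; last by rewrite tuple0.
  case: (admissible s x && _); last by rewrite big_pred0_eq.
  by rewrite sumr_const card_tuple expn0.
by move=> w; rewrite tuple0 /is_path /= andbT.
Qed.

Lemma paths_sumS b s N x y : admissible s x ->
  paths_sum b s N.+1 x y =
  \sum_(i < 3) (if i == 0 then b `|height x|%N else 1)
                 * paths_sum b s N (x + unit_step i) y.
Proof.
move=> adm; rewrite /paths_sum.
under [RHS]eq_bigr => i _ do rewrite mulr_sumr.
rewrite pair_big_dep /=.
rewrite (reindex (fun u : 'I_3 * N.-tuple 'I_3 => [tuple of u.1 :: u.2])) /=.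
  by apply: eq_bigl => -[i w]; rewrite is_path_cons adm.
exists (fun w : N.+1.-tuple 'I_3 => (thead w, [tuple of behead w])).
  by move=> [i w] _; congr pair; apply: val_inj.
by move=> w _; rewrite [RHS]tuple_eta.
Qed.

(** * Walks on pairs of gaps *)

(** Only the first summand tests the height, because the steps e_2 and e_3
lower it by 1; they are blocked instead when the gap they reduce is 0. *)
Fixpoint gap_walks (b : nat -> int) (s N p q : nat) : int :=
  if N is N'.+1 then
    (if (2 * p + q + 2 <= s)%N
       then b (2 * p + q)%N * gap_walks b s N' p.+1 q else 0)
    + (if p is p'.+1 then gap_walks b s N' p' q.+1 else 0)
    + (if q is q'.+1 then gap_walks b s N' p q' else 0)
  else ((p == 0%N) && (q == 0%N))%:R.

Definition has_gaps (x : point) (p q : nat) : Prop :=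
  x 0 0 = x 0 1 + p%:Z /\ x 0 1 = x 0 2 + q%:Z.

Lemma has_gaps_height x p q :
  has_gaps x p q -> height x = (2 * p + q)%N%:Z.
Proof. by case=> e1 e2; rewrite /height; lia. Qed.

Lemma has_gaps_admissible s x p q :
  has_gaps x p q -> admissible s x = (2 * p + q <= s)%N.
Proof.
move=> g; rewrite /admissible (has_gaps_height _ _ _ g).
by case: g => e1 e2; lia.
Qed.

Lemma coord_sumE x : coord_sum x = x 0 0 + x 0 1 + x 0 2.
Proof.
rewrite /coord_sum !big_ord_recl big_ord0 addr0 addrA.
by congr (x 0 _ + x 0 _ + x 0 _); apply: val_inj.
Qed.

Lemma unit_stepE x (i : 'I_3) j :
  (x + unit_step i) 0 j = x 0 j + (j == i)%:R.
Proof. by rewrite !mxE eqxx. Qed.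

(** The condition on the coordinate sums is the one that makes ending at the
diagonal point equivalent to ending with gaps (0,0). *)
Lemma paths_to_diagonal b s n N x p q :
  has_gaps x p q -> (2 * p + q <= s)%N ->
  coord_sum x + N%:Z = coord_sum (diag_point n) ->
  paths_sum b s N x (diag_point n) = gap_walks b s N p q.
Proof.
elim: N x p q => [|N IHN] x p q g hs.
  rewrite paths_sum0 (has_gaps_admissible _ _ _ _ g) hs !coord_sumE !mxE /=.
  case: g => e1 e2 esum; congr (_%:R); congr nat_of_bool.
  apply/eqP/andP => [ex|[/eqP p0 /eqP q0]].
    by move: e1 e2; rewrite ex !mxE => e1 e2; split; apply/eqP; lia.
  have [x0 x1 x2] : [/\ x 0 0 = n%:Z, x 0 1 = n%:Z & x 0 2 = n%:Z].
    by split; lia.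
  apply/rowP => -[[|[|[|//]]] lt_j3]; rewrite mxE.
  - by rewrite -x0; congr (x 0 _); apply: val_inj.
  - by rewrite -x1; congr (x 0 _); apply: val_inj.
  - by rewrite -x2; congr (x 0 _); apply: val_inj.
move=> esum.
have hx : height x = (2 * p + q)%N%:Z by exact: has_gaps_height.
have adm : admissible s x by rewrite (has_gaps_admissible _ _ _ _ g).
have esum' i : coord_sum (x + unit_step i) + N%:Z = coord_sum (diag_point n).
  rewrite -esum !coord_sumE !unit_stepE.
  by case: i => -[|[|[|//]]] lt_i3; rewrite -!val_eqE /=; lia.
rewrite paths_sumS // !big_ord_recl big_ord0 addr0 addrA hx absz_nat /=.
have -> : lift ord0 ord0 = 1 :> 'I_3 by apply: val_inj.
have -> : lift ord0 (lift ord0 ord0) = 2 :> 'I_3 by apply: val_inj.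
rewrite !mul1r; case: g => e1 e2; congr (_ + _ + _).
- have g1 : has_gaps (x + unit_step 0) p.+1 q.
    by rewrite /has_gaps !unit_stepE /=; lia.
  case: leqP => hs1; first by rewrite (IHN _ p.+1 q) //; lia.
  rewrite paths_sum_inadmissible ?mulr0 //.
  by rewrite (has_gaps_admissible _ _ _ _ g1); lia.
(* With p = 0 the step e_2 breaks x_1 >= x_2. *)
- case: p {hx} hs e1 => [|p] hs e1.
    apply: paths_sum_inadmissible.
    by rewrite /admissible !unit_stepE /=; lia.
  by apply: IHN => //; [rewrite /has_gaps !unit_stepE /=; lia | lia].
(* With q = 0 the step e_3 breaks x_2 >= x_3. *)
- case: q {hx} hs e2 => [|q] hs e2.
    apply: paths_sum_inadmissible.
    by rewrite /admissible !unit_stepE /=; lia.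
  by apply: IHN => //; [rewrite /has_gaps !unit_stepE /=; lia | lia].
Qed.

Lemma path_sum_to_diagonal b s n N x p q :
  has_gaps x p q -> (2 * p + q <= s)%N ->
  coord_sum x + N%:Z = coord_sum (diag_point n) ->
  path_sum b s x (diag_point n) = gap_walks b s N p q.
Proof.
move=> g hs esum.
rewrite -(paths_to_diagonal b s n N x p q g hs esum).
have -> : N = path_length x (diag_point n) by rewrite /path_length -esum; lia.
by [].
Qed.

(** * The case of height at most 4 *)

Lemma A_gap_walks b n : A b n = gap_walks b 4 (3 * n) 0 0.
Proof.
apply: path_sum_to_diagonal => //; first by rewrite /has_gaps !mxE.
by rewrite !coord_sumE !mxE; lia.
Qed.

Lemma B_gap_walks b n : B b n = gap_walks b 4 (3 * n) 1 1.
Proof.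
apply: path_sum_to_diagonal => //; first by rewrite /has_gaps !mxE.
by rewrite !coord_sumE !mxE /=; lia.
Qed.

Lemma C_gap_walks b n : C b n = gap_walks b 4 (3 * n) 0 3.
Proof.
apply: path_sum_to_diagonal => //; first by rewrite /has_gaps !mxE.
by rewrite !coord_sumE !mxE /=; lia.
Qed.

Lemma rows3_mul_col3 (u v w : 'rV[int]_3) (t : 'cV[int]_3) :
  rows3 u v w *m t = col3 ((u *m t) 0 0) ((v *m t) 0 0) ((w *m t) 0 0).
Proof.
apply/colP => i; rewrite !mxE.
by case: i => -[|[|[|//]]] lt_i3 /=; apply: eq_bigr => j _; rewrite !mxE.
Qed.

Lemma row3_mul_col3 (a b c x y z : int) :
  (row3 a b c *m col3 x y z) 0 0 = a * x + b * y + c * z.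
Proof. by rewrite mxE !big_ord_recl big_ord0 !mxE /= addr0 addrA. Qed.

Theorem proposition4p2 (b : nat -> int) (n : nat) (hn : (1 <= n)%N) :
  col3 (A b n) (B b n) (C b n) =
  rows3 (row3 (b 0%N) (b 0%N * b 1%N + b 0%N * b 2%N) 0)
        (row3 2 (2 * b 1%N + 2 * b 2%N) (b 2%N))
        (row3 1 (b 1%N + b 2%N) (b 2%N))
  *m col3 (A b n.-1) (B b n.-1) (C b n.-1).
Proof.
case: n hn => [//|n] _; rewrite rows3_mul_col3 !row3_mul_col3 succnK.
(* Once 3(n+1) is in the form 3 + 3n, simplification performs three steps. *)
rewrite !A_gap_walks !B_gap_walks !C_gap_walks mulnS /=.
by congr col3; ring.
Qed.
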